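(* Let $(\mathfrak g,[\cdot,\cdot,\cdot]_{\mathfrak g})$ be a finite-dimensional $3$-Lie algebra over $\mathbb R$ or $\mathbb C$. Then $\mathfrak g$ has a strict product structure if and only if $\mathfrak g$ admits a decomposition $\mathfrak g=\mathfrak g_+\oplus\mathfrak g_-$ (direct sum of vector spaces), where $\mathfrak g_+$ and $\mathfrak g_-$ are nonzero subalgebras of $\mathfrak g$ such that $[\mathfrak g_+,\mathfrak g_+,\mathfrak g_-]_{\mathfrak g}=0$ and $[\mathfrak g_-,\mathfrak g_-,\mathfrak g_+]_{\mathfrak g}=0$.
   Context: A $3$-Lie algebra is a vector space $\mathfrak g$ with a trilinear skew-symmetric bracket $[\cdot,\cdot,\cdot]_{\mathfrak g}$ satisfying $[x,y,[z,w,v]]=[[x,y,z],w,v]+[z,[x,y,w],v]+[z,w,[x,y,v]]$. An almost product structure on $\mathfrak g$ is a linear map $E:\mathfrak g\to\mathfrak g$ with $E^2=\mathrm{Id}$ and $E\neq\pm\mathrm{Id}$. It is called a strict product structure if $E[x,y,z]_{\mathfrak g}=[Ex,y,z]_{\mathfrak g}$ for all $x,y,z\in\mathfrak g$. *)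

(* Defs.v *)
From mathcomp Require Import all_boot all_order all_algebra.

Set Implicit Arguments.
Unset Strict Implicit.
Unset Printing Implicit Defensive.

Import GRing.Theory.
Local Open Scope ring_scope.

(* A 3-Lie algebra is a K-module V together with [br] satisfying
   [three_lie br].  The two adjacent transpositions generate 'S_3, so the
   two skew-symmetry clauses give the sign rule for every permutation of the
   three arguments. *)
Record three_lie (K : fieldType) (V : lmodType K) (br : V -> V -> V -> V) :
    Prop := ThreeLie {
  three_lie_linear1 : forall y z : V, linear (fun x => br x y z);
  three_lie_linear2 : forall x z : V, linear (fun y => br x y z);
  three_lie_linear3 : forall x y : V, linear (fun z => br x y z);
  three_lie_skew12 : forall x y z : V, br y x z = - br x y z;
  three_lie_skew23 : forall x y z : V, br x z y = - br x y z;
  three_lie_fundamental : forall x y z w v : V,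
    br x y (br z w v) = br (br x y z) w v + br z (br x y w) v
                        + br z w (br x y v)
}.

Section ThreeLieStructures.
Variables (K : fieldType) (g : vectType K) (br : g -> g -> g -> g).

Definition almost_product_structure (E : 'End(g)) : Prop :=
  [/\ (E \o E)%VF = \1%VF, E <> \1%VF & E <> - \1%VF].

Definition strict_product_structure (E : 'End(g)) : Prop :=
  almost_product_structure E /\
  forall x y z : g, E (br x y z) = br (E x) y z.

Definition three_lie_subalgebra (U : {vspace g}) : Prop :=
  forall x y z : g, x \in U -> y \in U -> z \in U -> br x y z \in U.

(* [U, V, W] = 0 *)
Definition bracket_vanishes (U V W : {vspace g}) : Prop :=
  forall x y z : g, x \in U -> y \in V -> z \in W -> br x y z = 0.

(* [directv (U + V)] says that the sum of U and V is direct. *)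
Definition direct_decomposition (U V : {vspace g}) : Prop :=
  (U + V)%VS = fullv /\ directv (U + V).

End ThreeLieStructures.

(* Main.v *)
Require Import Defs.
From mathcomp Require Import all_boot all_order all_algebra.
From mathcomp Require Import reals complex.

Set Implicit Arguments.
Unset Strict Implicit.
Unset Printing Implicit Defensive.

Import GRing.Theory.
Local Open Scope ring_scope.
Local Open Scope complex_scope.

Import passmx(leigenspace).

(** The two structures determine each other through eigenspaces.

    For a linear involution [E] in characteristic other than 2, the formula
    [x = 1/2 (x + E x) + 1/2 (x - E x)] splits [g] as the direct sum of the
    eigenspaces of [E] for [1] and [-1]; both are nonzero exactly because [E]
    is neither [-1] nor [1].  Skew-symmetry lets a strict [E] be pulled out of
    any of the three slots of the bracket, so each eigenspace of [E] is an
    ideal ([strict_eigenspace_ideal]).  Ideals are subalgebras, and a bracket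
    with entries from both eigenspaces lies in both, hence in their
    intersection, which is zero.

    Conversely a direct sum [U + V] carries the involution [reflection U V]
    equal to [1] on [U] and to [-1] on [V].  Since all mixed brackets vanish,
    the bracket is computed summand by summand ([bracket_split]):
    [[x, y, z] = [x_U, y_U, z_U] + [x_V, y_V, z_V]], the first term being in
    [U] and the second in [V].  Replacing [x] by its reflection, or reflecting
    the whole bracket, changes the sign of the second term in both cases, and
    this is the strictness condition.

    The argument is the same over every field in which [2] is invertible, and
    is carried out there ([strict_product_structureP]). *)

(** * Multilinearity and skew-symmetry of the bracket *)

Lemma bracketDl (K : fieldType) (V : lmodType K) (br : V -> V -> V -> V)
    (x x' y z : V) :
  three_lie br -> br (x + x') y z = br x y z + br x' y z.
Proof.
by move=> hbr; exact: (GRing.semilinear_linear (three_lie_linear1 hbr y z)).2.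
Qed.

Lemma bracketBl (K : fieldType) (V : lmodType K) (br : V -> V -> V -> V)
    (x x' y z : V) :
  three_lie br -> br (x - x') y z = br x y z - br x' y z.
Proof.
by move=> hbr; exact: (zmod_morphism_linear (three_lie_linear1 hbr y z)).
Qed.

Lemma bracketZl (K : fieldType) (V : lmodType K) (br : V -> V -> V -> V)
    (a : K) (x y z : V) :
  three_lie br -> br (a *: x) y z = a *: br x y z.
Proof.
by move=> hbr; exact: (scalable_linear (three_lie_linear1 hbr y z)).
Qed.

Lemma bracketDm (K : fieldType) (V : lmodType K) (br : V -> V -> V -> V)
    (x y y' z : V) :
  three_lie br -> br x (y + y') z = br x y z + br x y' z.
Proof.
by move=> hbr; exact: (GRing.semilinear_linear (three_lie_linear2 hbr x z)).2.
Qed.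

Lemma bracketDr (K : fieldType) (V : lmodType K) (br : V -> V -> V -> V)
    (x y z z' : V) :
  three_lie br -> br x y (z + z') = br x y z + br x y z'.
Proof.
by move=> hbr; exact: (GRing.semilinear_linear (three_lie_linear3 hbr x y)).2.
Qed.

(** By skew-symmetry the position of the odd entry is irrelevant. *)
Lemma bracket_vanishes_perm (K : fieldType) (g : vectType K)
    (br : g -> g -> g -> g) (U V : {vspace g}) (u u' v : g) :
  three_lie br -> bracket_vanishes br U U V ->
  u \in U -> u' \in U -> v \in V ->
  [/\ br u u' v = 0, br u v u' = 0 & br v u u' = 0].
Proof.
move=> hbr UUV0 Uu Uu' Vv.
have uu'v0 : br u u' v = 0 by exact: UUV0.
have uvu'0 : br u v u' = 0 by rewrite (three_lie_skew23 hbr) uu'v0 oppr0.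
by split=> //; rewrite (three_lie_skew12 hbr) uvu'0 oppr0.
Qed.

(** * Eigenspaces of a strict product structure *)

Lemma mem_leigenspace (K : fieldType) (g : vectType K) (E : 'End(g)) (a : K)
    (x : g) :
  (x \in leigenspace E a) = (E x == a *: x).
Proof.
by rewrite memv_ker add_lfunE opp_lfunE scale_lfunE id_lfunE subr_eq0.
Qed.

Lemma involution_decomposition (K : fieldType) (g : vectType K)
    (E : 'End(g)) :
  2 != 0 :> K -> (E \o E)%VF = \1%VF ->
  direct_decomposition (leigenspace E 1) (leigenspace E (- 1)).
Proof.
move=> two_neq0 EE1.
have EE x : E (E x) = x by rewrite -comp_lfunE EE1 id_lfunE.
split.
  apply/eqP; rewrite eqEsubv subvf; apply/subvP => x _.
  have -> : x = 2^-1 *: (x + E x) + 2^-1 *: (x - E x).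
    by rewrite -scalerDr addrACA subrr addr0 -mulr2n -scaler_nat scalerA
               mulVf // scale1r.
  rewrite memv_add // memvZ // mem_leigenspace.
    by rewrite scale1r linearD /= EE addrC.
  by rewrite scaleN1r linearB /= EE opprB.
apply/directv_addP/eqP; rewrite -subv0; apply/subvP => x.
rewrite memv_cap !mem_leigenspace scale1r scaleN1r memv0.
by case/andP=> /eqP ->; rewrite -addr_eq0 -mulr2n -scaler_nat scaler_eq0
                                (negPf two_neq0).
Qed.

Lemma strict_eigenspace_ideal (K : fieldType) (g : vectType K)
    (br : g -> g -> g -> g) (E : 'End(g)) (a : K) (x y z : g) :
  three_lie br -> (forall x y z : g, E (br x y z) = br (E x) y z) ->
  [|| x \in leigenspace E a, y \in leigenspace E a | z \in leigenspace E a] ->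
  br x y z \in leigenspace E a.
Proof.
move=> hbr Ebr.
have ideal1 u v w : u \in leigenspace E a -> br u v w \in leigenspace E a.
  by rewrite !mem_leigenspace Ebr => /eqP ->; rewrite bracketZl.
have ideal2 u v w : v \in leigenspace E a -> br u v w \in leigenspace E a.
  by rewrite (three_lie_skew12 hbr) memvN; exact: ideal1.
case/or3P; [exact: ideal1 | exact: ideal2 |].
by rewrite (three_lie_skew23 hbr) memvN; exact: ideal2.
Qed.

(** * The reflection attached to a direct sum *)

Definition reflection (K : fieldType) (g : vectType K) (U V : {vspace g}) :
  'End(g) := daddv_pi U V - daddv_pi V U.

Lemma reflectionD (K : fieldType) (g : vectType K) (U V : {vspace g})
    (u v : g) :
  directv (U + V) -> u \in U -> v \in V -> reflection U V (u + v) = u - v.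
Proof.
move=> /directv_addP UV0 Uu Vv.
have VU0 : (V :&: U = 0)%VS by rewrite capvC.
(* A projection kills the other summand, as the two projections add up to the
   identity. *)
have piUv : daddv_pi U V v = 0.
  have /(daddv_pi_add UV0) : v \in (U + V)%VS by rewrite (subvP (addvSr U V)).
  by rewrite (daddv_pi_id VU0 Vv) => /eqP; rewrite -subr_eq0 addrK => /eqP.
have piVu : daddv_pi V U u = 0.
  have /(daddv_pi_add VU0) : u \in (V + U)%VS by rewrite (subvP (addvSr V U)).
  by rewrite (daddv_pi_id UV0 Uu) => /eqP; rewrite -subr_eq0 addrK => /eqP.
rewrite add_lfunE opp_lfunE !linearD /= (daddv_pi_id UV0 Uu).
by rewrite (daddv_pi_id VU0 Vv) piUv piVu oppr0 addr0 add0r.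
Qed.

Lemma reflection_almost_product (K : fieldType) (g : vectType K)
    (U V : {vspace g}) :
  2 != 0 :> K -> direct_decomposition U V -> U <> 0%VS -> V <> 0%VS ->
  almost_product_structure (reflection U V).
Proof.
move=> two_neq0 [UVf dUV] U0 V0.
have eq_opp0 (w : g) : w = - w -> w = 0.
  move=> /eqP; rewrite -addr_eq0 -mulr2n -scaler_nat scaler_eq0.
  by rewrite (negPf two_neq0) => /eqP.
split.
- apply/lfunP => x; rewrite comp_lfunE id_lfunE.
  have /memv_addP[u Uu [v Vv ->]] : x \in (U + V)%VS by rewrite UVf memvf.
  by rewrite !reflectionD ?memvN // opprK.
- move=> R1; apply: V0; apply/eqP; rewrite -subv0; apply/subvP => v Vv.
  rewrite memv0; apply/eqP/eq_opp0.
  by rewrite -[RHS]add0r -(reflectionD dUV (mem0v U) Vv) R1 id_lfunE add0r.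
- move=> RN1; apply: U0; apply/eqP; rewrite -subv0; apply/subvP => u Uu.
  rewrite memv0; apply/eqP/eq_opp0.
  rewrite -[LHS]subr0 -(reflectionD dUV Uu (mem0v V)) RN1.
  by rewrite opp_lfunE id_lfunE addr0.
Qed.

Lemma bracket_split (K : fieldType) (g : vectType K)
    (br : g -> g -> g -> g) (U V : {vspace g}) (u1 u2 u3 v1 v2 v3 : g) :
  three_lie br -> bracket_vanishes br U U V -> bracket_vanishes br V V U ->
  u1 \in U -> u2 \in U -> u3 \in U -> v1 \in V -> v2 \in V -> v3 \in V ->
  br (u1 + v1) (u2 + v2) (u3 + v3) = br u1 u2 u3 + br v1 v2 v3.
Proof.
move=> hbr UUV0 VVU0 U1 U2 U3 V1 V2 V3.
have [uuv0 _ _] := bracket_vanishes_perm hbr UUV0 U1 U2 V3.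
have [_ uvu0 _] := bracket_vanishes_perm hbr UUV0 U1 U3 V2.
have [_ _ vuu0] := bracket_vanishes_perm hbr UUV0 U2 U3 V1.
have [vvu0 _ _] := bracket_vanishes_perm hbr VVU0 V1 V2 U3.
have [_ vuv0 _] := bracket_vanishes_perm hbr VVU0 V1 V3 U2.
have [_ _ uvv0] := bracket_vanishes_perm hbr VVU0 V2 V3 U1.
rewrite !(bracketDl, bracketDm, bracketDr) //.
by rewrite uuv0 uvu0 vuu0 vvu0 vuv0 uvv0 !addr0 !add0r.
Qed.

(** * The equivalence *)

Theorem strict_product_structureP (K : fieldType) (g : vectType K)
    (br : g -> g -> g -> g) :
  2 != 0 :> K -> three_lie br ->
  (exists E : 'End(g), strict_product_structure br E) <->
  (exists gp gm : {vspace g},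
     [/\ direct_decomposition gp gm,
         gp <> 0%VS /\ gm <> 0%VS,
         three_lie_subalgebra br gp /\ three_lie_subalgebra br gm,
         bracket_vanishes br gp gp gm &
         bracket_vanishes br gm gm gp]).
Proof.
move=> two_neq0 hbr; split; last first.
  move=> [U [V [dec [U0 V0] [subU subV] UUV0 VVU0]]].
  exists (reflection U V); split; first exact: reflection_almost_product.
  case: dec => UVf dUV x y z.
  have split_UV w : exists2 u, u \in U & exists2 v, v \in V & w = u + v.
    by apply/memv_addP; rewrite UVf memvf.
  have [u1 U1 [v1 V1 ->]] := split_UV x.
  have [u2 U2 [v2 V2 ->]] := split_UV y.
  have [u3 U3 [v3 V3 ->]] := split_UV z.
  rewrite [reflection U V (u1 + v1)]reflectionD // bracketBl //.
  (* Pad [u1] and [v1] with a zero component to split their brackets too. *)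
  rewrite -[in br u1 _ _](addr0 u1) -[in X in _ - br X _ _](add0r v1).
  rewrite !(@bracket_split _ _ br U V) ?mem0v //.
  have br0 y' z' : br 0 y' z' = 0.
    by rewrite -[0 in LHS](subrr 0) bracketBl ?subrr.
  by rewrite !br0 addr0 add0r reflectionD ?subU ?subV.
move=> [E [[EE1 E1 EN1] Ebr]].
have [sumE dirE] := involution_decomposition two_neq0 EE1.
have cap0 := directv_addP dirE.
have ideal := strict_eigenspace_ideal hbr Ebr.
exists (leigenspace E 1), (leigenspace E (- 1)); split=> //.
- split=> eig0.
  + apply: EN1; apply/lfunP => x; rewrite opp_lfunE id_lfunE.
    have: x \in leigenspace E (- 1)
      by rewrite -[leigenspace _ _]add0v -eig0 sumE memvf.
    by rewrite mem_leigenspace scaleN1r => /eqP.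
  + apply: E1; apply/lfunP => x; rewrite id_lfunE.
    have: x \in leigenspace E 1
      by rewrite -[leigenspace _ _]addv0 -eig0 sumE memvf.
    by rewrite mem_leigenspace scale1r => /eqP.
- by split=> x y z xE _ _; apply: ideal; rewrite xE.
- move=> x y z xE _ zE; apply/eqP; rewrite -memv0 -cap0 memv_cap.
  by rewrite !ideal ?xE ?zE ?orbT.
- move=> x y z xE _ zE; apply/eqP; rewrite -memv0 -cap0 memv_cap.
  by rewrite !ideal ?xE ?zE ?orbT.
Qed.

Theorem corollary5p6 (R : realType) :
  (forall (g : vectType R) (br : g -> g -> g -> g), three_lie br ->
     (exists E : 'End(g), strict_product_structure br E) <->
     (exists gp gm : {vspace g},
        [/\ direct_decomposition gp gm,
            gp <> 0%VS /\ gm <> 0%VS,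
            three_lie_subalgebra br gp /\ three_lie_subalgebra br gm,
            bracket_vanishes br gp gp gm &
            bracket_vanishes br gm gm gp]))
  /\
  (forall (g : vectType R[i]) (br : g -> g -> g -> g), three_lie br ->
     (exists E : 'End(g), strict_product_structure br E) <->
     (exists gp gm : {vspace g},
        [/\ direct_decomposition gp gm,
            gp <> 0%VS /\ gm <> 0%VS,
            three_lie_subalgebra br gp /\ three_lie_subalgebra br gm,
            bracket_vanishes br gp gp gm &
            bracket_vanishes br gm gm gp])).
Proof.
by split=> g br; apply: strict_product_structureP; rewrite Num.Theory.pnatr_eq0.
Qed.
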